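(* There is an absolute constant $C$ such that for any locally finite positive Borel measures $\omega,\sigma$ on $\mathbb{R}$ with no common point masses, $$\mathcal{E}\le C(\mathcal{A}_2+\mathcal{H}),$$ and similarly $\mathcal{E}^{*}\le C(\mathcal{A}_2+\mathcal{H}^{*})$. Here $\mathcal{E}$ is the best constant in the Energy Condition $$\sum_{r\ge1}\omega(I_r)\,\mathsf{E}(I_r,\omega)^2\,\mathsf{P}(I_r,\sigma\mathbf{1}_{I_0})^2\le\mathcal{E}^2\sigma(I_0),$$ required for all bounded intervals $I_0$ and all decompositions $I_0=\bigcup_{r\ge1}I_r$ into pairwise disjoint intervals, and $\mathcal{E}^{*}$ is the corresponding constant with $\omega$ and $\sigma$ interchanged.
   Context: Poisson integral: $\mathsf{P}(I,\mu)=\int_{\mathbb{R}}\frac{|I|}{(|I|+\mathrm{dist}(x,I))^{2}}\,\mu(dx)$. $\mathcal{A}_2^2=\sup_I\mathsf{P}(I,\omega)\mathsf{P}(I,\sigma)$ over bounded intervals $I$. Energy: $\mathbb{E}_I^{\mu}g=\mu(I)^{-1}\int_I g\,d\mu$ and $\mathsf{E}(I,\mu)=\Big[\mathbb{E}_I^{\mu(dx)}\big[\mathbb{E}_I^{\mu(dx')}\frac{x-x'}{|I|}\big]^2\Big]^{1/2}$ (and $0$ if $\mu(I)=0$). Testing constants: $\mathcal{H}$ and $\mathcal{H}^*$ are the smallest constants such that for all bounded intervals $I$, $\int_I|H(\mathbf{1}_I\sigma)|^2d\omega\le\mathcal{H}^2\sigma(I)$ and $\int_I|H(\mathbf{1}_I\omega)|^2d\sigma\le(\mathcal{H}^*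 )^2\omega(I)$. Here $H\mu(x)=\mathrm{p.v.}\int\frac{1}{x-y}\mu(dy)$, and inequalities for $H$ are understood through smooth truncations: with $\zeta$ a fixed smooth nondecreasing function, $\zeta(t)=0$ for $t\le\frac12$, $\zeta(t)=1$ for $t\ge1$, the kernel is replaced (up to an irrelevant sign) by $\frac{1}{y-x}\zeta(|x-y|/\delta)$ and the inequality is required uniformly in $\delta>0$. All constants may be $+\infty$. *)

(* Defs.v *)
From HB Require Import structures.
From mathcomp Require Import all_boot all_order all_algebra.
From mathcomp Require Import all_classical all_reals all_analysis.
Import Order.TTheory GRing.Theory Num.Theory.
Import numFieldNormedType.Exports.

Set Implicit Arguments.
Unset Strict Implicit.
Unset Printing Implicit Defensive.

Local Open Scope classical_set_scope.
Local Open Scope ring_scope.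

Notation borel_measure R := {measure set (measurableTypeR R) -> \bar R}.

Definition locally_finite (R : realType) (mu : borel_measure R) : Prop :=
  forall x : R, exists U : set R, [/\ open U, U x & (mu U < +oo)%E].

Definition no_common_point_mass (R : realType) (mu nu : borel_measure R) : Prop :=
  forall x : R, mu [set x] = 0%E \/ nu [set x] = 0%E.

(* Endpoints may or may not belong to the interval. The empty set and the
   one-point sets are included: since [0^-1 = 0], their Poisson integrals and
   energies are [0], and (as the truncated kernel vanishes on the diagonal)
   their testing inequalities are trivial, so they affect no constant below.
   Allowing empty pieces lets sequences encode finite decompositions. *)
Definition bounded_interval (R : realType) (I : set R) : Prop :=
  is_interval I /\ bounded_set I.

Definition length (R : realType) (I : set R) : R := fine (lebesgue_measure I).

Definition dist (R : realType) (x : R) (I : set R) : R :=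
  inf [set `|x - y| | y in I].

(* [poisson I mu D] is P(I, mu 1_D). *)
Definition poisson (R : realType) (I : set R) (mu : borel_measure R)
    (D : set R) : \bar R :=
  (\int[mu]_(x in D) (length I / (length I + dist x I) ^+ 2)%:E)%E.

Definition A2 (R : realType) (omega sigma : borel_measure R) : \bar R :=
  sqrte (ereal_sup
    [set (poisson I omega setT * poisson I sigma setT)%E
       | I in [set I : set R | bounded_interval I]]).

Definition average (R : realType) (I : set R) (mu : borel_measure R)
    (g : R -> R) : R :=
  (fine (mu I))^-1 * \int[mu]_(x in I) g x.

Definition energy (R : realType) (I : set R) (mu : borel_measure R) : R :=
  if mu I == 0%E then 0 else
  Num.sqrt (average I mu (fun x =>
    (average I mu (fun x' => (x - x') / length I)) ^+ 2)).

Definition smooth (R : realType) (f : R -> R) : Prop :=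
  forall (n : nat) (x : R), derivable (derive1n n f) x 1.

Definition cutoff (R : realType) (zeta : R -> R) : Prop :=
  [/\ smooth zeta,
      {homo zeta : s t / s <= t},
      forall t, t <= 2^-1 -> zeta t = 0
    & forall t, 1 <= t -> zeta t = 1].

(* The truncation at scale [delta] of H(1_I mu), evaluated at [x]. *)
Definition truncated_hilbert (R : realType) (zeta : R -> R) (delta : R)
    (I : set R) (mu : borel_measure R) (x : R) : R :=
  \int[mu]_(y in I) ((y - x)^-1 * zeta (`|x - y| / delta)).

(* [+oo] when no real constant satisfies [P]. *)
Definition best_constant (R : realType) (P : R -> Prop) : \bar R :=
  ereal_inf [set c%:E | c in [set c : R | 0 <= c /\ P c]].

(* [testing zeta sigma omega] is H, and [testing zeta omega sigma] is H^*. *)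
Definition testing (R : realType) (zeta : R -> R)
    (sigma omega : borel_measure R) : \bar R :=
  best_constant (fun c : R =>
    forall (delta : R) (I : set R), 0 < delta -> bounded_interval I ->
      (\int[omega]_(x in I)
          (`|truncated_hilbert zeta delta I sigma x| ^+ 2)%:E
        <= (c ^+ 2)%:E * sigma I)%E).

Definition interval_decomposition (R : realType) (I0 : set R)
    (I : nat -> set R) : Prop :=
  [/\ forall r, is_interval (I r), trivIset setT I & I0 = \bigcup_r I r].

(* [energy_constant sigma omega] is the constant for the energies of [omega]
   and the Poisson integrals of [sigma]; exchange the arguments for the dual
   one. *)
Definition energy_constant (R : realType)
    (sigma omega : borel_measure R) : \bar R :=
  best_constant (fun c : R =>
    forall (I0 : set R) (I : nat -> set R),
      bounded_interval I0 -> interval_decomposition I0 I ->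
      (\sum_(0 <= r <oo)
          omega (I r) * ((energy (I r) omega) ^+ 2)%:E
            * poisson (I r) sigma I0 ^+ 2
        <= (c ^+ 2)%:E * sigma I0)%E).

(* Main.v *)
Require Import Defs.
From HB Require Import structures.
From mathcomp Require Import all_boot all_order all_algebra.
From mathcomp Require Import all_classical all_reals all_analysis.
From mathcomp Require Import measurable_realfun.
From mathcomp Require Import ring lra.
Import Order.TTheory GRing.Theory Num.Theory.
Import numFieldNormedType.Exports.
Set Implicit Arguments.
Unset Strict Implicit.
Unset Printing Implicit Defensive.
Local Open Scope classical_set_scope.
Local Open Scope ring_scope.

(* Let [I] be one piece of [I0], [D] its complement in [I0] and [f] the truncated
   Hilbert transform of [1_D sigma]. As [D] has no point in [I], the kernel
   [1 / (y - x)] is increasing in [x] on [I] for each [y] in [D], with slope at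
   least [1 / (|I| + dist y I) ^+ 2]. Hence [f], up to an error that vanishes with
   the truncation scale, increases on [I] at least as fast as [lam * x], where
   [|I| * lam] is the Poisson integral of [1_D sigma], and so
   [lam ^+ 2 * \int_I (x - mean) ^+ 2 domega <= \int_I f ^+ 2 domega].
   Splitting [1_D = 1_I0 - 1_I] bounds the right-hand side by the testing
   condition on [I0], summed over the pieces, and on each piece. The part of the
   Poisson integral carried by [I] itself is absorbed by [A2]. *)

(** * Bounded intervals: finite measure, length and distance *)

Section intervals.
Context {R : realType}.
Implicit Types (I D : set R) (x y : R) (mu : borel_measure R).

Lemma bounded_set_itv I : bounded_set I -> exists M : R, I `<=` `[- M, M].
Proof.
move=> [M [_ IM]]; exists (`|M| + 1) => x Ix /=.
by rewrite in_itv/= -ler_norml IM// ltr_pwDr// ler_norm.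
Qed.

Lemma bounded_interval_measurable I : bounded_interval I -> measurable I.
Proof. by case=> itvI _; exact: is_interval_measurable. Qed.

(** By compactness, finitely many open sets of finite measure cover a segment containing [I]. *)
Lemma locally_finite_bounded mu I : locally_finite mu -> measurable I ->
  bounded_set I -> (mu I < +oo)%E.
Proof.
move=> lf mI /bounded_set_itv[M IM].
have /choice[U HU] := lf.
have : compact (`[- M, M]%classic : set R) by exact: segment_compact.
rewrite compact_cover => /(_ R setT U) [|x _|F _ UF].
- by move=> x _; have [] := HU x.
- by exists x => //; have [] := HU x.
have FU := subset_trans IM UF.
apply: le_lt_trans (content_sub_fsum mu _ _ mI FU) _.
- by apply/finite_fsetP; exists F.
- by move=> i _; apply: open_measurable; have [] := HU i.
rewrite fsbig_finite/=; last by apply/finite_fsetP; exists F.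
apply: lte_sum_pinfty => i _.
by have [] := HU i.
Qed.

Lemma length_ge0 I : 0 <= length I.
Proof. exact: fine_ge0. Qed.

(** The segment between two points of [I] lies in [I], so its Lebesgue measure is at most that of
    [I], which is finite and hence not altered by [fine]. *)
Lemma ler_dist_length I x y : bounded_interval I -> I x -> I y ->
  `|x - y| <= length I.
Proof.
move=> bI; have mI := bounded_interval_measurable bI.
wlog xy : x y / x <= y => [wlg Ix Iy|Ix Iy].
  by case: (leP x y) => [|/ltW] xy; [|rewrite distrC]; exact: wlg.
rewrite distrC ger0_norm ?subr_ge0// -lee_fin /length fineK; last first.
  rewrite ge0_fin_numE//; case: bI => _ /bounded_set_itv[M IM].
  set J : set R := `[- M, M]%classic in IM.
  have mJ : measurable J by exact: measurable_itv.
  have : (lebesgue_measure I <= lebesgue_measure J)%E.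
    by apply: le_measure; rewrite ?inE.
  move=> /le_lt_trans; apply.
  by rewrite lebesgue_measure_itv/=; case: ifP => // _; rewrite -EFinB ltry.
have -> : (y - x)%:E = lebesgue_measure (`[x, y]%classic : set R).
  rewrite lebesgue_measure_itv/= lte_fin; case: ltgtP xy => // -> _.
  by rewrite subrr.
apply: le_measure; rewrite ?inE//.
by move=> z /=; rewrite in_itv/=; case: bI => itvI _; exact: itvI.
Qed.

Lemma dist_has_lbound I x : has_lbound [set `|x - y| | y in I].
Proof. by exists 0 => _ [y _ <-]. Qed.

Lemma dist_ge0 I x : 0 <= dist x I.
Proof.
have [->|/set0P[y Iy]] := eqVneq I set0; first by rewrite /dist image_set0 inf0.
by apply: lb_le_inf; [exists `|x - y|, y|move=> _ [z _ <-]].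
Qed.

Lemma dist_le I x y : I y -> dist x I <= `|x - y|.
Proof. by move=> Iy; apply: ge_inf; [exact: dist_has_lbound|exists y]. Qed.

Lemma dist_mem I x : I x -> dist x I = 0.
Proof.
move=> Ix; apply/eqP; rewrite eq_le dist_ge0 andbT.
by rewrite (le_trans (dist_le _ Ix))// subrr normr0.
Qed.

(** This makes [length I + dist y I] an upper bound for the distances in the denominator of the
    kernel increment, which is how the Poisson kernel enters. *)
Lemma ler_dist_lengthD I x y : bounded_interval I -> I x ->
  `|y - x| <= length I + dist y I.
Proof.
move=> bI Ix; rewrite -lerBlDl; apply: lb_le_inf.
  by exists `|y - x|, x.
move=> _ [z Iz <-]; rewrite lerBlDl (le_trans (ler_distD z _ _))// addrC.
by rewrite lerD2r ler_dist_length.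
Qed.

Lemma dist_lipschitz I x y : dist x I - dist y I <= `|x - y|.
Proof.
have [->|/set0P[w Iw]] := eqVneq I set0.
  by rewrite /dist !image_set0 inf0 subrr.
rewrite lerBlDr -lerBlDl; apply: lb_le_inf; first by exists `|y - w|, w.
move=> _ [z Iz <-]; rewrite lerBlDl.
by rewrite (le_trans (dist_le _ Iz))// ler_distD.
Qed.

Lemma measurable_dist I : measurable_fun [set: R] (fun x : R => dist x I).
Proof.
apply: continuous_measurable_fun => /= x.
apply/(@cvgrPdist_lt _ R^o) => e e0.
near=> y.
have xy : `|x - y| < e by near: y; exact: (@cvgr_dist_lt _ R^o).
apply: le_lt_trans xy; rewrite ler_norml dist_lipschitz andbT lerNl opprB.
by rewrite distrC dist_lipschitz.
Unshelve. all: end_near. Qed.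

(** Inversion is continuous away from [0], and on a singleton every function is measurable. *)
Lemma measurable_invr : measurable_fun [set: R] (@GRing.inv R).
Proof.
rewrite -(setUv [set (0 : R)]); apply/measurable_funU => //; first exact: measurableC.
split; first exact: measurable_fun_set1.
apply: open_continuous_measurable_fun; first by apply/closed_openC/closed_eq.
by move=> x /set_mem /eqP x0; exact: inv_continuous.
Qed.

End intervals.

(** * The truncated Hilbert kernel: measurability, size and monotonicity *)

Section kernel.
Context {R : realType}.

Lemma measurable_fun_Rintegral d1 d2 (T1 : measurableType d1)
    (T2 : measurableType d2) (mu : {measure set T2 -> \bar R}) (D : set T2)
    (K : T1 * T2 -> R) :
  measurable D -> (mu D < +oo)%E -> measurable_fun setT K ->
  measurable_fun setT (fun x => \int[mu]_(y in D) K (x, y)).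
Proof.
move=> mD muD mK; apply: measurableT_comp; first exact: fine_measurable.
(* Tonelli is applied to the finite measure obtained by restricting [mu] to [D], separately for the
   positive and negative parts of [K]. *)
pose nu := mfrestr mD muD.
have mint (F : T1 * T2 -> \bar R) : measurable_fun setT F ->
    (forall z, (0 <= F z)%E) ->
    measurable_fun setT (fun x => \int[mu]_(y in D) F (x, y))%E.
  move=> mF F0.
  pose G (z : T1 * T2) : \bar R := if z.2 \in D then F z else 0%E.
  rewrite [X in measurable_fun _ X](_ : _ =
      fun x => (\int[nu]_y G (x, y))%E); last first.
    apply/funext => x; rewrite (@eq_measure_integral _ _ _ _ nu).
      by rewrite integral_mkcond.
    by move=> A mA AD; rewrite /nu/= /mfrestr /mrestr setIidl.
  apply: (measurable_fun_fubini_tonelli_F (m2 := nu) G).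
    apply: measurable_fun_ifT => //; apply: (measurable_fun_bool true).
    rewrite setTI (_ : _ @^-1` _ = setT `*` D); first exact: measurableX.
    by apply/seteqP; split => [[x y]/= /set_mem//|[x y]/= [_ /mem_set]].
  by move=> z; rewrite /G; case: ifP.
rewrite [X in measurable_fun _ X](_ : _ = fun x =>
  (\int[mu]_(y in D) ((EFin \o K)^\+ (x, y)) -
   \int[mu]_(y in D) ((EFin \o K)^\- (x, y)))%E); last first.
  apply/funext => x; rewrite integralE; congr (_ - _)%E;
    by apply: eq_integral => y _; rewrite !(funeposE, funenegE).
apply: emeasurable_funB; apply: mint => //.
- exact/measurable_funepos/measurable_EFinP.
- exact/measurable_funeneg/measurable_EFinP.
Qed.

Variable zeta : R -> R.
Hypothesis zetaP : cutoff zeta.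

Lemma cutoff_ge0 t : 0 <= zeta t.
Proof.
have [_ nd z0 _] := zetaP.
by rewrite -(z0 (Num.min t 2^-1)) ?ge_min ?lexx ?orbT// nd// ge_min lexx.
Qed.

Lemma cutoff_le1 t : zeta t <= 1.
Proof.
have [_ nd _ z1] := zetaP.
by rewrite -(z1 (Num.max t 1)) ?le_max ?lexx ?orbT// nd// le_max lexx.
Qed.

Lemma measurable_cutoff : measurable_fun [set: R] zeta.
Proof. by have [_ nd _ _] := zetaP; exact: nondecreasing_measurable. Qed.

Definition hilbert_kernel (delta : R) (x y : R) : R :=
  (y - x)^-1 * zeta (`|x - y| / delta).

Lemma measurable_hilbert_kernel delta :
  measurable_fun setT (fun z : R * R => hilbert_kernel delta z.1 z.2).
Proof.
apply: measurable_funM.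
  apply: (measurableT_comp (@measurable_invr R)).
  exact: measurable_funB.
apply: (measurableT_comp measurable_cutoff); apply: measurable_funM => //.
by apply: measurableT_comp => //; exact: measurable_funB.
Qed.

(** The cutoff vanishes when [y] is within [delta / 2] of [x]; elsewhere [1 / |y - x|] is below
    [2 / delta] and the cutoff is at most [1]. *)
Lemma hilbert_kernel_le delta x y : 0 < delta ->
  `|hilbert_kernel delta x y| <= 2 / delta.
Proof.
move=> d0; have [_ _ z0 _] := zetaP; rewrite /hilbert_kernel normrM normfV.
have [xy|xy] := leP (`|x - y| / delta) 2^-1.
  by rewrite z0// normr0 mulr0 divr_ge0// ltW.
rewrite (ger0_norm (cutoff_ge0 _)) -[leRHS]mulr1 ler_pM ?cutoff_ge0 ?cutoff_le1//.
rewrite distrC -(invrK (2 / delta)) lef_pV2 ?posrE ?invf_div ?divr_gt0//.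
  by rewrite ltW// mulrC -ltr_pdivlMr.
by rewrite (lt_trans _ (_ : delta / 2 < _)) ?divr_gt0// mulrC -ltr_pdivlMr.
Qed.

(* Moving from [x] to [x'] changes [1 / (y - x)] by [(x' - x) / ((y - x) (y - x'))],
   whose denominator is at most [d ^+ 2]; the truncation only matters where one
   of the two distances is less than [delta], and there both products are
   bounded by constants. *)
Lemma hilbert_kernel_increment (delta d x x' y : R) : 0 < delta -> 0 < d ->
  0 < (y - x) * (y - x') -> `|y - x| <= d -> `|y - x'| <= d -> `|x - x'| <= d ->
  (x - x') ^+ 2 / d ^+ 2
    - 3 * ((`|x - y| < delta)%R%:R + (`|x' - y| < delta)%R%:R)
  <= (hilbert_kernel delta x y - hilbert_kernel delta x' y) * (x - x').
Proof.
move=> delta0 d0; have [_ _ _ z1] := zetaP; rewrite /hilbert_kernel.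
rewrite (distrC x y) (distrC x' y).
rewrite (_ : x - x' = (y - x') - (y - x)); last by ring.
move: (y - x) (y - x') => u v uv0 ud vd vud.
have [u0 v0] : u != 0 /\ v != 0.
  by move: uv0; rewrite lt0r mulf_eq0 negb_or => /andP[/andP[]].
(* If both distances are at least [delta], both cutoffs equal [1] and the increment is exactly
   [(v - u) ^+ 2 / (u * v)]. *)
have [uvd|] := boolP ((delta <= `|u|) && (delta <= `|v|)).
  move/andP : uvd => [du dv].
  rewrite ltNge du ltNge dv/= addr0 mulr0 subr0.
  rewrite !z1 ?ler_pdivlMr ?mul1r// !mulr1.
  rewrite (_ : (u^-1 - v^-1) * (v - u) = (v - u) ^+ 2 / (u * v)); last first.
    by field; rewrite u0 v0.
  rewrite ler_wpM2l ?sqr_ge0// lef_pV2 ?posrE ?exprn_gt0//.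
  by rewrite -(ger0_norm (ltW uv0)) normrM expr2 ler_pM.
rewrite negb_and -!ltNge => uvd.
have ind : 1 <= (`|u| < delta)%R%:R + (`|v| < delta)%R%:R :> R.
  by case/orP : uvd => ->; rewrite ?lerDl ?lerDr ler0n.
have sq1 : (v - u) ^+ 2 / d ^+ 2 <= 1.
  rewrite ler_pdivrMr ?exprn_gt0// mul1r -real_normK ?num_real//.
  by rewrite lerXn2r// nnegrE ltW.
have zu0 := cutoff_ge0 (`|u| / delta); have zu1 := cutoff_le1 (`|u| / delta).
have zv0 := cutoff_ge0 (`|v| / delta); have zv1 := cutoff_le1 (`|v| / delta).
move: (zeta (_ / _)) (zeta (_ / _)) zu0 zu1 zv0 zv1 => b a a0 a1 b0 b1.
have vu : 0 < v / u.
  rewrite (_ : v / u = u * v * u^-1 ^+ 2); last by field; rewrite u0.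
  by rewrite mulr_gt0// exprn_even_gt0//= invr_eq0.
have uv : 0 < u / v by rewrite -invf_div invr_gt0.
(* As [u] and [v] have the same sign, the right-hand side is at least [- a - b >= -2]; the left-hand
   side is at most [1 - 3], whence the constant [3]. *)
rewrite (_ : _ * (v - u) = a * (v / u) - a + (b * (u / v) - b)); last first.
  by field; rewrite u0 v0.
have := mulr_ge0 a0 (ltW vu); have := mulr_ge0 b0 (ltW uv).
lra.
Qed.

End kernel.

(** * Integrals over one interval: bounded convergence, mean and variance *)

Section single_interval.
Context {R : realType}.

Lemma bounded_integrable d (T : measurableType d)
    (mu : {measure set T -> \bar R}) (D : set T) (f : T -> R) (M : R) :
  measurable D -> (mu D < +oo)%E -> measurable_fun D f ->
  (forall x, D x -> `|f x| <= M) -> mu.-integrable D (EFin \o f).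
Proof.
move=> mD muD mf fM; apply: measurable_bounded_integrable => //.
exists M; split; first exact: num_real.
by move=> N MN x Dx; apply: le_trans (fM x Dx) (ltW MN).
Qed.

Section integrable_real.
Context d (T : measurableType d) (mu : {measure set T -> \bar R}).
Variables (D : set T) (f g : T -> R).
Hypotheses (mD : measurable D) (intf : mu.-integrable D (EFin \o f)).

Lemma integrable_mulrl k : mu.-integrable D (EFin \o (fun x => k * f x)).
Proof. exact: (integrableZl mD k intf). Qed.

Hypothesis intg : mu.-integrable D (EFin \o g).

Lemma integrable_addr : mu.-integrable D (EFin \o (fun x => f x + g x)).
Proof. exact: (integrableD mD intf intg). Qed.

Lemma integrable_subr : mu.-integrable D (EFin \o (fun x => f x - g x)).
Proof. exact: (integrableB mD intf intg). Qed.

End integrable_real.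

Lemma Rintegral_bounded_cvg0 d (T : measurableType d)
    (mu : {measure set T -> \bar R}) (D : set T) (f_ : nat -> T -> R) (M : R) :
  measurable D -> (mu D < +oo)%E -> (forall n, measurable_fun D (f_ n)) ->
  (forall n x, D x -> `|f_ n x| <= M) ->
  (forall x, D x -> f_ n x @[n --> \oo] --> (0 : R)) ->
  \int[mu]_(x in D) f_ n x @[n --> \oo] --> (0 : R).
Proof.
move=> mD muD mf fM f0.
have [] := @dominated_convergence _ _ _ mu D mD (fun n => EFin \o f_ n)
  (cst 0%E) (cst M%:E).
- by move=> n; exact/measurable_EFinP.
- exact: measurable_cst.
- by apply: aeW => x Dx; apply: cvg_EFin; [exact: nearW|exact: f0].
- apply: (bounded_integrable (f := cst M) (M := `|M|)) => //.
- by apply: aeW => x n Dx; rewrite /= lee_fin fM.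
move=> _ _; rewrite integral0 => /fine_cvg; exact.
Qed.

(** If [m] were outside [I], then [x - m] would have constant sign on [I]; a zero integral would
    force [x = m] almost everywhere on [I], making [I] null. *)
Lemma mean_mem (mu : borel_measure R) (I : set R) (m : R) :
  bounded_interval I -> (mu I < +oo)%E -> mu I != 0%E ->
  \int[mu]_(x in I) (x - m) = 0 -> I m.
Proof.
move=> bI muI mu0 int0; apply: contrapT => Im.
have mI := bounded_interval_measurable bI.
have [itvI /bounded_set_itv[M IM]] := bI.
have id_int : mu.-integrable I (EFin \o (fun x : R => x - m)).
  apply: (bounded_integrable (M := M + `|m|)) => //.
    exact: measurable_funB.
  move=> x /IM/=; rewrite in_itv/= -ler_norml => xM.
  by rewrite (le_trans (ler_normB _ _))// lerD2r.
have abs0 : \int[mu]_(x in I) `|x - m| = 0.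
  have [[x Ix xm]|] := pselect (exists2 x, I x & x < m).
    rewrite (@eq_Rintegral _ _ _ mu I (fun x : R => - 1 * (x - m))).
      by rewrite RintegralZl// int0 mulr0.
    move=> y /set_mem Iy; rewrite mulN1r ler0_norm// subr_le0 leNgt.
    by apply/negP => my; apply: Im; apply: (itvI x y) => //; rewrite !ltW.
  move=> /forall2NP xm; rewrite (@eq_Rintegral _ _ _ mu I (fun x : R => x - m))//.
  move=> y /set_mem Iy; rewrite ger0_norm// subr_ge0 leNgt; apply/negP.
  by have [] := xm y.
(* The real integral is a [fine], which is [0] at infinity too, so finiteness is needed to recover
   the extended integral. *)
have fin0 : (\int[mu]_(x in I) `|(x - m)%:E| = 0)%E.
  have : (\int[mu]_(x in I) `|(x - m)%:E| \is a fin_num)%E.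
    by rewrite ge0_fin_numE ?integral_ge0//; case/integrableP : id_int.
  by move=> /fineK <-; rewrite [fine _]abs0.
have [+ _] := ae_eq_integral_abs mu mI (measurable_int _ id_int).
move=> /(_ fin0) [N [mN N0 IN]].
move/eqP : mu0; apply; apply: (@subset_measure0 _ _ _ mu I N mI mN _ N0).
move=> x Ix; apply: IN => /= /(_ Ix) []/eqP.
by rewrite subr_eq0 => /eqP xm; apply: Im; rewrite -xm.
Qed.

(* Expanding [0 <= (f x - lam * (x - m)) ^+ 2], the cross term [f x * (x - m)]
   integrates to the covariance of [f] with [x], which does not see the
   constant [c]. *)
Lemma variance_le (mu : borel_measure R) (I : set R) (f e : R -> R)
    (m c lam : R) :
  measurable I -> 0 <= lam ->
  mu.-integrable I (EFin \o (fun x => f x ^+ 2)) ->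
  mu.-integrable I (EFin \o e) ->
  mu.-integrable I (EFin \o (fun x : R => x - m)) ->
  mu.-integrable I (EFin \o (fun x : R => (x - m) ^+ 2)) ->
  \int[mu]_(x in I) (x - m) = 0 ->
  (forall x, I x -> lam * (x - m) ^+ 2 - e x <= (f x - c) * (x - m)) ->
  lam ^+ 2 * \int[mu]_(x in I) (x - m) ^+ 2
    - 2 * lam * \int[mu]_(x in I) e x <= \int[mu]_(x in I) f x ^+ 2.
Proof.
move=> mI lam0 if2 ie ix ix2 int0 fe.
(* The zero term [2 * lam * c * \int (x - m)] is added so that the inequality holds pointwise under
   the integral. *)
rewrite -[leLHS]addr0 -(mulr0 (2 * lam * c)) -int0 -mulNr -!RintegralZl//.
rewrite -!RintegralD//;
  do ?[exact: integrable_mulrl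
      |by apply: integrable_addr => //; exact: integrable_mulrl].
apply: le_Rintegral => //.
  by do 2?apply: integrable_addr => //; exact: integrable_mulrl.
move=> x Ix; have := fe x Ix.
rewrite -subr_ge0 => /(mulr_ge0 lam0).
have := sqr_ge0 (f x - lam * (x - m)); nra.
Qed.

End single_interval.

(** * Truncated transforms of a finite measure, and mass near a point *)

Section localization.
Context {R : realType}.
Variable zeta : R -> R.
Hypothesis zetaP : cutoff zeta.

Section truncated_hilbert.
Variables (sigma : borel_measure R) (J : set R).
Hypotheses (mJ : measurable J) (sJ : (sigma J < +oo)%E).

Lemma integrable_hilbert_kernel delta x : 0 < delta ->
  sigma.-integrable J (EFin \o (hilbert_kernel zeta delta x)).
Proof.
move=> d0; apply: (bounded_integrable (M := 2 / delta)) => //.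
  apply: (measurable_funS measurableT) => //.
  exact: (measurableT_comp (measurable_hilbert_kernel zetaP delta)
    (pair1_measurable x)).
by move=> y _; exact: hilbert_kernel_le.
Qed.

Lemma measurable_truncated_hilbert delta :
  measurable_fun [set: R] (truncated_hilbert zeta delta J sigma).
Proof.
exact (measurable_fun_Rintegral (T1 := R) (mu := sigma)
  (K := fun z => hilbert_kernel zeta delta z.1 z.2) mJ sJ
  (measurable_hilbert_kernel zetaP delta)).
Qed.

Lemma truncated_hilbert_le delta x : 0 < delta ->
  `|truncated_hilbert zeta delta J sigma x| <= 2 / delta * fine (sigma J).
Proof.
move=> d0; have iK := integrable_hilbert_kernel x d0.
apply: (le_trans (le_normr_Rintegral (mu := sigma) mJ iK)).
rewrite -(Rintegral_cst sigma mJ); apply: le_Rintegral => //.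
- exact: integrable_norm iK.
- by apply: (bounded_integrable (M := `|2 / delta|)).
- by move=> y _; exact: hilbert_kernel_le.
Qed.

End truncated_hilbert.

Section near_mass.
Variables (sigma : borel_measure R) (D : set R).
Hypotheses (mD : measurable D) (sD : (sigma D < +oo)%E).

(** Integrated over [y], each indicator in the error of [hilbert_kernel_increment] becomes such a
    mass. *)
Definition near_mass (delta x : R) : R :=
  \int[sigma]_(y in D) (`|x - y| < delta)%R%:R.

Let measurable_near delta :
  measurable_fun setT (fun z : R * R => (`|z.1 - z.2| < delta)%R%:R : R).
Proof.
have -> : (fun z : R * R => (`|z.1 - z.2| < delta)%R%:R : R) =
    (fun z : R * R => if `|z.1 - z.2| < delta then 1 else 0).
  by apply/funext => z; case: ifP.
apply: measurable_fun_ifT => //; apply: measurable_fun_ltr => //.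
by apply: measurableT_comp => //; exact: measurable_funB.
Qed.

Lemma integrable_near delta x :
  sigma.-integrable D (EFin \o (fun y => (`|x - y| < delta)%R%:R)).
Proof.
apply: (bounded_integrable (M := 1)) => //.
  apply: (measurable_funS measurableT) => //.
  exact: (measurableT_comp (measurable_near delta) (pair1_measurable x)).
by move=> y _; case: (_ < _); rewrite ?normr1// normr0.
Qed.

Lemma measurable_near_mass delta : measurable_fun [set: R] (near_mass delta).
Proof.
exact (measurable_fun_Rintegral (T1 := R) (mu := sigma)
  (K := fun z => (`|z.1 - z.2| < delta)%R%:R) mD sD (measurable_near delta)).
Qed.

Lemma near_mass_ge0 delta x : 0 <= near_mass delta x.
Proof. by apply: Rintegral_ge0 => y _; rewrite ler0n. Qed.

Lemma near_mass_le delta x : near_mass delta x <= fine (sigma D).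
Proof.
rewrite -[leRHS]mul1r -(Rintegral_cst sigma mD); apply: le_Rintegral => //.
- exact: integrable_near.
- by apply: (bounded_integrable (M := 1)) => // y _; rewrite normr1.
- by move=> y _; case: (_ < _).
Qed.

(** Each [y] in [D] differs from [x], so its indicator is eventually [0]; the indicators are
    dominated by [1], integrable on [D]. *)
Lemma near_mass_cvg0 x : ~ D x ->
  near_mass n.+1%:R^-1 x @[n --> \oo] --> (0 : R).
Proof.
move=> Dx; apply: (Rintegral_bounded_cvg0 (M := 1)) => //.
- by move=> n; apply/measurable_EFinP; exact: measurable_int (integrable_near _ x).
- by move=> n y _; case: (_ < _); rewrite ?normr1// normr0.
move=> y Dy; apply: cvg_near_cst.
have xy : 0 < `|x - y|.
  by rewrite normr_gt0 subr_eq0; apply/eqP => xy; apply: Dx; rewrite xy.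
near=> n; rewrite ltNge (_ : _ <= _)//.
apply: ltW; near: n; exact: (near_infty_natSinv_lt (PosNum xy)).
Unshelve. all: end_near. Qed.

End near_mass.

End localization.

(** * Variance on [I] against the transform of the measure outside [I] *)

Section localized_energy.
Context {R : realType}.
Variable zeta : R -> R.
Hypothesis zetaP : cutoff zeta.
Variables (sigma omega : borel_measure R) (I D : set R).
Hypotheses (bI : bounded_interval I) (lI : 0 < length I).
Hypotheses (oI : (omega I < +oo)%E) (oI0 : omega I != 0%E).
Hypotheses (mD : measurable D) (sD : (sigma D < +oo)%E).
Hypothesis DI : forall x, D x -> ~ I x.

Let L := length I.
Let mI : measurable I := bounded_interval_measurable bI.

Let w (y : R) : R := ((L + dist y I) ^+ 2)^-1.

Let Ldist_gt0 y : 0 < L + dist y I.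
Proof. by rewrite ltr_wpDr// dist_ge0. Qed.

Lemma integrable_inv_dist : sigma.-integrable D
  (EFin \o (fun y : R => ((length I + dist y I) ^+ 2)^-1)).
Proof.
apply: (bounded_integrable (M := (L ^+ 2)^-1)) => //.
  apply: (measurable_funS measurableT) => //.
  apply: (measurableT_comp (@measurable_invr R)); apply: measurable_funX.
  by apply: measurable_funD => //; exact: measurable_dist.
move=> y _; have Ly := Ldist_gt0 y.
rewrite ger0_norm ?invr_ge0 ?exprn_ge0 ?(ltW Ly)//.
rewrite lef_pV2 ?posrE ?exprn_gt0//.
by rewrite lerXn2r ?nnegrE ?(ltW lI) ?(ltW Ly)// lerDl dist_ge0.
Qed.

Let lam : R := \int[sigma]_(y in D) w y.

Let lam_ge0 : 0 <= lam.
Proof.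
apply: Rintegral_ge0 => y _; rewrite invr_ge0 exprn_ge0//; exact: ltW.
Qed.

Variable m : R.
Hypothesis mean : \int[omega]_(x in I) (x - m) = 0.

Let V : R := \int[omega]_(x in I) (x - m) ^+ 2.

Let Im : I m. Proof. exact: mean_mem mean. Qed.

Let T (delta x : R) := truncated_hilbert zeta delta D sigma x.

(** A point [y] lying between [x] and [m] would belong to the interval [I], which is disjoint from
    [D]. *)
Let same_side x y : I x -> D y -> 0 < (y - x) * (y - m).
Proof.
move=> Ix /DI Iy; have [itvI _] := bI; rewrite ltNge; apply/negP => yxm.
apply: Iy; have [yx|xy] := leP y x.
  have [my|ym] := leP m y; first by apply: (itvI m x) => //; rewrite my.
  move: yxm; rewrite nmulr_lle0 ?subr_lt0// subr_ge0 => xy.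
  by apply: (itvI x x) => //; rewrite xy.
have [my|ym] := leP y m; first by apply: (itvI x m) => //; rewrite ltW.
by move: yxm; rewrite pmulr_rle0 ?subr_gt0// subr_le0 leNgt ym.
Qed.

(** This is [hilbert_kernel_increment] with [x' = m] and [d = length I + dist y I], integrated over
    [y] in [D]. *)
Let increment delta x : 0 < delta -> I x ->
  lam * (x - m) ^+ 2 - 3 * (near_mass sigma D delta x + near_mass sigma D delta m)
  <= (T delta x - T delta m) * (x - m).
Proof.
move=> delta0 Ix; rewrite [in leLHS]mulrC.
have iw := integrable_inv_dist.
have in1 := integrable_near mD sD delta x.
have in2 := integrable_near mD sD delta m.
have iK1 := integrable_hilbert_kernel zetaP mD sD x delta0.
have iK2 := integrable_hilbert_kernel zetaP mD sD m delta0.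
rewrite /near_mass /T /truncated_hilbert [leRHS]mulrC.
rewrite -RintegralB// -RintegralD// -!RintegralZl//;
  [|exact: integrable_subr|exact: integrable_addr].
rewrite -RintegralB//;
  [|exact: integrable_mulrl|exact/integrable_mulrl/integrable_addr].
apply: le_Rintegral => //.
- apply: integrable_subr => //; first exact: integrable_mulrl.
  exact/integrable_mulrl/integrable_addr.
- exact/integrable_mulrl/integrable_subr.
move=> y Dy; rewrite [leRHS]mulrC; apply: hilbert_kernel_increment => //.
- exact: same_side.
- exact: ler_dist_lengthD.
- exact: ler_dist_lengthD.
- by rewrite (le_trans (ler_dist_length bI Ix Im))// lerDl dist_ge0.
Qed.

(** [variance_le] is applied to the transform with [c] its value at [m]. The error is a multiple of
    the integral of near masses, which tend to [0] at every point of [I] and are bounded by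
    [sigma D]. *)
Lemma localized_energy_le : exists2 err : nat -> R,
  err n @[n --> \oo] --> (0 : R) &
  forall n, lam ^+ 2 * V <=
    \int[omega]_(x in I) T n.+1%:R^-1 x ^+ 2 + err n.
Proof.
pose e n x := 3 * (near_mass sigma D n.+1%:R^-1 x + near_mass sigma D n.+1%:R^-1 m).
pose B := 3 * (fine (sigma D) + fine (sigma D)).
have me n : measurable_fun I (e n).
  apply: (measurable_funS measurableT) => //; apply: measurable_funM => //.
  by apply: measurable_funD => //; exact: measurable_near_mass.
have eB n x : `|e n x| <= B.
  rewrite ger0_norm; last by rewrite mulr_ge0// addr_ge0// near_mass_ge0.
  by rewrite ler_wpM2l// lerD// near_mass_le.
exists (fun n => 2 * lam * \int[omega]_(x in I) e n x).
  rewrite -[X in _ --> X](mulr0 (2 * lam)); apply: cvgMl_tmp.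
  apply: (Rintegral_bounded_cvg0 (M := B)) => //.
  move=> x Ix; rewrite -[X in _ --> X](mulr0 3) -[in X in _ --> X](addr0 0).
  apply: cvgMl_tmp; apply: cvgD; by apply: near_mass_cvg0 => // /DI.
move=> n; rewrite -lerBlDr.
have d0 : 0 < n.+1%:R^-1 :> R by rewrite invr_gt0.
have bx x : I x -> `|x - m| <= L by move=> Ix; exact: ler_dist_length.
have mx : measurable_fun I (fun x : R => x - m) by exact: measurable_funB.
apply: (variance_le (c := T n.+1%:R^-1 m)) => //.
- apply: (bounded_integrable (M := (2 / n.+1%:R^-1 * fine (sigma D)) ^+ 2)) => //.
    apply: measurable_funX; apply: (measurable_funS measurableT) => //.
    exact: measurable_truncated_hilbert.
  by move=> x _; rewrite normrX lerXn2r ?nnegrE// truncated_hilbert_le//.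
- by apply: (bounded_integrable (mu := omega) (M := B) mI oI (me n)) => x _; exact: eB.
- exact: (bounded_integrable (M := L)).
- apply: (bounded_integrable (M := L ^+ 2)) => //; first exact: measurable_funX.
  by move=> x Ix; rewrite normrX lerXn2r ?nnegrE ?(ltW lI)// bx.
- by move=> x Ix; exact: increment.
Qed.

End localized_energy.

(** * Poisson integrals, and energy as a normalized variance *)

Section energy_term.
Context {R : realType}.
Implicit Types (mu sigma omega : borel_measure R) (I D : set R).

Lemma measurable_poisson_kernel I (A : set R) :
  measurable_fun A (fun x : R => (length I / (length I + dist x I) ^+ 2)%:E).
Proof.
apply: (measurable_funS measurableT) => //; apply/measurable_EFinP.
apply: measurable_funM => //; apply: (measurableT_comp (@measurable_invr R)).
by apply: measurable_funX; apply: measurable_funD => //; exact: measurable_dist.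
Qed.

Lemma poisson_kernel_ge0 I (x : R) :
  (0 <= (length I / (length I + dist x I) ^+ 2)%:E)%E.
Proof.
by rewrite lee_fin divr_ge0 ?length_ge0// exprn_ge0// addr_ge0 ?length_ge0 ?dist_ge0.
Qed.

Lemma poisson_ge0 I mu D : (0 <= poisson I mu D)%E.
Proof. by apply: integral_ge0 => x _; exact: poisson_kernel_ge0. Qed.

Lemma poisson_degenerate I mu D : length I = 0 -> poisson I mu D = 0%E.
Proof.
by move=> L0; rewrite /poisson; under eq_integral do rewrite L0 mul0r; rewrite integral0.
Qed.

Lemma poisson_self I mu : bounded_interval I -> 0 < length I ->
  (mu I < +oo)%E -> poisson I mu I = (fine (mu I) / length I)%:E.
Proof.
move=> bI L0 muI; have mI := bounded_interval_measurable bI.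
rewrite /poisson (@eq_integral _ _ _ mu I (cst (length I)^-1%:E)).
  rewrite integral_cst// mulrC EFinM fineK// ge0_fin_numE//.
move=> x /set_mem Ix; rewrite dist_mem// addr0 /=; congr EFin.
by field; rewrite gt_eqF.
Qed.

Lemma poisson_le I mu D : measurable D ->
  (poisson I mu D <= poisson I mu setT)%E.
Proof.
move=> mD; apply: ge0_subset_integral => //; first exact: measurable_poisson_kernel.
by move=> x _; exact: poisson_kernel_ge0.
Qed.

Lemma poisson_setU I mu (A B : set R) : measurable A -> measurable B ->
  [disjoint A & B] -> poisson I mu (A `|` B) = (poisson I mu A + poisson I mu B)%E.
Proof.
move=> mA mB AB; apply: ge0_integral_setU => //.
  exact: measurable_poisson_kernel.
by move=> x _; exact: poisson_kernel_ge0.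
Qed.

Definition mean I mu : R := average I mu id.

Section moments.
Variables (mu : borel_measure R) (I : set R).
Hypotheses (bI : bounded_interval I).
Hypotheses (muI : (mu I < +oo)%E) (muI0 : mu I != 0%E).

Let mI : measurable I := bounded_interval_measurable bI.

Let mu_gt0 : 0 < fine (mu I).
Proof. by rewrite fine_gt0// muI lt0e muI0 measure_ge0. Qed.

Lemma integrable_affine k : mu.-integrable I (EFin \o (fun x : R => x - k)).
Proof.
have [_ /bounded_set_itv[M IM]] := bI.
apply: (bounded_integrable (M := M + `|k|)) => //; first exact: measurable_funB.
move=> x /IM/=; rewrite in_itv/= -ler_norml => xM.
by rewrite (le_trans (ler_normB _ _))// lerD2r.
Qed.

Let integrable_id : mu.-integrable I (EFin \o (fun x : R => x)).
Proof.
rewrite (_ : (fun x : R => x) = (fun x : R => x - 0)); last first.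
  by apply/funext => x; rewrite subr0.
exact: integrable_affine.
Qed.

Lemma integral_sub_mean : \int[mu]_(x in I) (x - mean I mu) = 0.
Proof.
rewrite RintegralB//; last exact: (bounded_integrable (M := `|mean I mu|)).
by rewrite Rintegral_cst// /mean /average mulrAC mulVf ?mul1r ?subrr// gt_eqF.
Qed.

Lemma variance_le_length :
  \int[mu]_(x in I) (x - mean I mu) ^+ 2 <= length I ^+ 2 * fine (mu I).
Proof.
have Im := mean_mem bI muI muI0 integral_sub_mean.
have xL x : I x -> (x - mean I mu) ^+ 2 <= length I ^+ 2.
  move=> Ix; rewrite -real_normK ?num_real// lerXn2r ?nnegrE ?length_ge0//.
  exact: ler_dist_length.
rewrite -(Rintegral_cst mu mI); apply: le_Rintegral => //.
- apply: (bounded_integrable (M := length I ^+ 2)) => //.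
    by apply: measurable_funX; exact: measurable_funB.
  by move=> x Ix; rewrite ger0_norm ?sqr_ge0// xL.
- exact: (bounded_integrable (M := `|length I ^+ 2|)).
Qed.

(** The inner average of [x - x'] is [x - mean I mu], so the squared energy is the averaged squared
    deviation divided by [length I ^+ 2]. *)
Lemma energy_variance : 0 < length I ->
  fine (mu I) * energy I mu ^+ 2 =
  \int[mu]_(x in I) (x - mean I mu) ^+ 2 / length I ^+ 2.
Proof.
move=> L0; rewrite /energy (negbTE muI0).
have inner x : average I mu (fun x' => (x - x') / length I) =
    (x - mean I mu) / length I.
  rewrite /average RintegralZr//; last first.
    rewrite (_ : (fun x' : R => x - x') = (fun x' => -1 * (x' - x))); last first.
      by apply/funext => x'; ring.
    exact/integrable_mulrl/integrable_affine.
  rewrite RintegralB//; last exact: (bounded_integrable (M := `|x|)).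
  rewrite Rintegral_cst// /mean /average; field.
  by rewrite !gt_eqF.
rewrite (_ : (fun x => _) = fun x => (x - mean I mu) ^+ 2 / length I ^+ 2); last first.
  by apply/funext => x; rewrite inner expr_div_n.
rewrite sqr_sqrtr; last first.
  rewrite /average mulr_ge0 ?invr_ge0 ?(ltW mu_gt0)//.
  apply: Rintegral_ge0 => x _.
  by rewrite divr_ge0 ?sqr_ge0.
rewrite /average mulrA divff ?gt_eqF// mul1r RintegralZr//.
have Im := mean_mem bI muI muI0 integral_sub_mean.
apply: (bounded_integrable (M := length I ^+ 2)) => //.
  by apply: measurable_funX; exact: measurable_funB.
move=> x Ix; rewrite normrX lerXn2r ?nnegrE ?length_ge0//.
exact: ler_dist_length.
Qed.

End moments.

End energy_term.

(** * The energy estimate for one piece *)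

Section energy_condition.
Context {R : realType}.
Variable zeta : R -> R.
Hypothesis zetaP : cutoff zeta.
Variables (sigma omega : borel_measure R) (I0 : set R).
Hypotheses (mI0 : measurable I0).
Hypotheses (sI0 : (sigma I0 < +oo)%E) (oI0 : (omega I0 < +oo)%E).

Let T (delta : R) (I : set R) := truncated_hilbert zeta delta I sigma.

Let sqrD_le (u v : R) : (u + v) ^+ 2 <= 2 * u ^+ 2 + 2 * v ^+ 2.
Proof. by have := sqr_ge0 (u - v); nra. Qed.

Lemma truncated_hilbertD delta (I : set R) x : 0 < delta ->
  measurable I -> I `<=` I0 -> T delta (I0 `\` I) x = T delta I0 x - T delta I x.
Proof.
move=> d0 mI II0; suff -> : T delta I0 x = T delta I x + T delta (I0 `\` I) x.
  by rewrite addrAC subrr add0r.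
rewrite {1}/T /truncated_hilbert -{1}(setDUK II0) Rintegral_setU//.
- exact: measurableD.
- by rewrite setDUK//; exact: (integrable_hilbert_kernel zetaP mI0 sI0 x d0).
- by apply/disj_setPS => y [Iy [_ nIy]].
Qed.

Lemma integrable_truncated_hilbert_sqr delta (I J : set R) : 0 < delta ->
  measurable I -> I `<=` I0 -> measurable J -> J `<=` I0 ->
  omega.-integrable I (EFin \o (fun x => T delta J x ^+ 2)).
Proof.
move=> d0 mI II0 mJ JI0.
have sJ : (sigma J < +oo)%E by apply: le_lt_trans sI0; apply: le_measure; rewrite ?inE.
have oI : (omega I < +oo)%E by apply: le_lt_trans oI0; apply: le_measure; rewrite ?inE.
apply: (bounded_integrable (M := (2 / delta * fine (sigma J)) ^+ 2)) => //.
  apply: measurable_funX; apply: (measurable_funS measurableT) => //.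
  exact: measurable_truncated_hilbert.
move=> x _; rewrite normrX lerXn2r ?nnegrE ?mulr_ge0 ?invr_ge0 ?(ltW d0)//.
exact: (truncated_hilbert_le zetaP mJ sJ x d0).
Qed.

(** The Poisson integral over [I0] is [sigma I / |I| + |I| * lam], with [lam] coming from [D].
    Squaring the sum costs a factor [2], and so does splitting the transform of [D]: hence [4],
    [4 * h ^+ 2] and [2 * a ^+ 2]. *)
Lemma energy_term_le (I : set R) (a h : R) :
  bounded_interval I -> I `<=` I0 ->
  (poisson I omega setT * poisson I sigma setT <= (a ^+ 2)%:E)%E ->
  (forall delta, 0 < delta ->
    (\int[omega]_(x in I) (`|T delta I x| ^+ 2)%:E <= (h ^+ 2)%:E * sigma I)%E) ->
  exists2 err : nat -> R, err n @[n --> \oo] --> (0 : R) &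
  forall n, (omega I * (energy I omega ^+ 2)%:E * poisson I sigma I0 ^+ 2 <=
    (4 * \int[omega]_(x in I) T n.+1%:R^-1 I0 x ^+ 2 +
      (4 * h ^+ 2 + 2 * a ^+ 2) * fine (sigma I) + err n)%:E)%E.
Proof.
move=> bI II0 Aa Th; have mI := bounded_interval_measurable bI.
have sI : (sigma I < +oo)%E by apply: le_lt_trans sI0; apply: le_measure; rewrite ?inE.
have oI : (omega I < +oo)%E by apply: le_lt_trans oI0; apply: le_measure; rewrite ?inE.
have S0 n : 0 <= \int[omega]_(x in I) T n.+1%:R^-1 I0 x ^+ 2.
  by apply: Rintegral_ge0 => x _; exact: sqr_ge0.
(* If [I] is null for [omega] or has length [0], the left-hand side vanishes and a zero error
   serves. *)
have degenerate : (omega I * (energy I omega ^+ 2)%:E * poisson I sigma I0 ^+ 2 = 0)%E ->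
  exists2 err : nat -> R, err n @[n --> \oo] --> (0 : R) &
  forall n, (omega I * (energy I omega ^+ 2)%:E * poisson I sigma I0 ^+ 2 <=
    (4 * \int[omega]_(x in I) T n.+1%:R^-1 I0 x ^+ 2 +
      (4 * h ^+ 2 + 2 * a ^+ 2) * fine (sigma I) + err n)%:E)%E.
  move=> ->; exists (cst 0); first exact: cvg_cst.
  move=> n; rewrite lee_fin addr0; apply: addr_ge0; first exact: mulr_ge0.
  by apply: mulr_ge0; [apply: addr_ge0; exact/mulr_ge0/sqr_ge0|exact: fine_ge0].
have [oNZ|oNZ] := eqVneq (omega I) 0%E.
  by apply: degenerate; rewrite oNZ !mul0e.
have := length_ge0 I; rewrite le_eqVlt => /predU1P[L0|L0].
  by apply: degenerate; rewrite poisson_degenerate// expe2 !mule0.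
clear degenerate.
set D := I0 `\` I; have mD : measurable D by exact: measurableD.
have sD : (sigma D < +oo)%E.
  by apply: le_lt_trans sI0; apply: le_measure; rewrite ?inE//; exact: subDsetl.
have DI x : D x -> ~ I x by case.
have [err err0 errP] := localized_energy_le zetaP bI L0 oI oNZ mD sD DI
  (integral_sub_mean bI oI oNZ).
exists (fun n => 2 * err n).
  by rewrite -[X in _ --> X](mulr0 2); apply: cvgMl_tmp.
set lam := \int[sigma]_(x in D) _ in errP.
set V := \int[omega]_(x in I) _ in errP.
have lam0 : 0 <= lam.
  apply: Rintegral_ge0 => y _.
  by rewrite invr_ge0 exprn_ge0// addr_ge0 ?length_ge0// dist_ge0.
have PD : poisson I sigma D = (length I * lam)%:E.
  rewrite /poisson /lam -RintegralZl//; last exact: integrable_inv_dist.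
  rewrite /Rintegral fineK//; apply: integrable_fin_num => //.
  by apply: integrable_mulrl => //; exact: integrable_inv_dist.
have PI0 : poisson I sigma I0 = (fine (sigma I) / length I + length I * lam)%:E.
  rewrite -(setDUK II0) poisson_setU//; last by apply/disj_setPS => y [Iy [_ nIy]].
  by rewrite poisson_self// PD.
have sIE : sigma I = (fine (sigma I))%:E by rewrite fineK// ge0_fin_numE.
have oIE : omega I = (fine (omega I))%:E by rewrite fineK// ge0_fin_numE.
set s := fine (sigma I) in sIE PI0 *; set o := fine (omega I) in oIE *.
have s0 : 0 <= s by exact: fine_ge0.
have o_gt0 : 0 < o by rewrite fine_gt0// oI lt0e oNZ measure_ge0.
(* Restricting both Poisson integrals to [I] leaves only the densities of the two measures on
   [I]. *)
have os : (o / length I) * (s / length I) <= a ^+ 2.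
  rewrite -lee_fin EFinM -!poisson_self//; apply: le_trans Aa.
  by apply: lee_pmul; rewrite ?poisson_ge0 ?poisson_le.
move=> n; set delta := n.+1%:R^-1.
have d0 : 0 < delta by rewrite invr_gt0.
have TI : \int[omega]_(x in I) T delta I x ^+ 2 <= h ^+ 2 * s.
  have iT := integrable_truncated_hilbert_sqr d0 mI II0 mI II0.
  rewrite -lee_fin /Rintegral fineK; last exact: integrable_fin_num.
  rewrite EFinM -sIE; apply: le_trans (Th _ d0).
  by under [leRHS]eq_integral do rewrite real_normK ?num_real//.
have TD : \int[omega]_(x in I) T delta D x ^+ 2 <=
    2 * \int[omega]_(x in I) T delta I0 x ^+ 2
    + 2 * (\int[omega]_(x in I) T delta I x ^+ 2).
  have i1 := integrable_truncated_hilbert_sqr d0 mI II0 mI II0.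
  have i2 := integrable_truncated_hilbert_sqr d0 mI II0 mI0 (@subset_refl _ I0).
  have i3 := integrable_truncated_hilbert_sqr d0 mI II0 mD (@subDsetl _ I0 I).
  rewrite -!RintegralZl// -RintegralD//; [|exact: integrable_mulrl..].
  apply: le_Rintegral => //.
    by apply: integrable_addr => //; exact: integrable_mulrl.
  move=> x _; rewrite /D truncated_hilbertD//.
  by rewrite -(sqrrN (T delta I x)).
rewrite PI0 oIE expe2 -!EFinM lee_fin -expr2 (energy_variance bI oI oNZ L0).
(* The part carried by [I]: [V / length I ^+ 2] is at most [o], and [os] absorbs the product of the
   densities. *)
have vs : V / length I ^+ 2 * (s / length I) ^+ 2 <= a ^+ 2 * s.
  have vL := variance_le_length bI oI oNZ.
  apply: (@le_trans _ _ (o * (s / length I) ^+ 2)).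
    by rewrite ler_wpM2r ?sqr_ge0// ler_pdivrMr ?exprn_gt0// mulrC.
  rewrite (_ : o * _ = (o / length I) * (s / length I) * s).
    by rewrite ler_wpM2r.
  by field; rewrite gt_eqF.
have V0 : 0 <= V by apply: Rintegral_ge0 => x _; exact: sqr_ge0.
have vl : V / length I ^+ 2 * (length I * lam) ^+ 2 = lam ^+ 2 * V.
  by field; rewrite gt_eqF.
have V0L : 0 <= V / length I ^+ 2 by rewrite divr_ge0 ?sqr_ge0.
apply: le_trans (ler_wpM2l V0L (sqrD_le _ _)) _.
rewrite mulrDr !(mulrCA _ 2) vl.
move: TD TI (errP n) vs; rewrite -/delta -/D -/(T delta D).
move: (\int[omega]_(x in I) T delta D x ^+ 2) => TD.
move: (\int[omega]_(x in I) T delta I0 x ^+ 2) => TI0.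
move: (\int[omega]_(x in I) T delta I x ^+ 2) => TI.
move: (err n) (lam ^+ 2 * V) (V / _ * _) => e E F; clear -a h s.
lra.
Qed.

End energy_condition.

(** * Summation over the pieces and comparison of best constants *)

Section energy_constant.
Context {R : realType}.
Implicit Types (sigma omega : borel_measure R).

(** All pieces use the same scale [1 / (n + 1)], so their integrals of the transform of [I0] add up
    inside one testing inequality. That gives [4 * h ^+ 2]; the testing on the pieces and the [A2]
    part give [4 * h ^+ 2 + 2 * a ^+ 2]. *)
Lemma energy_sum_le (zeta : R -> R) sigma omega (I0 : set R)
    (I : nat -> set R) (a h : R) :
  cutoff zeta -> locally_finite omega -> locally_finite sigma ->
  (forall J : set R, bounded_interval J ->
    (poisson J omega setT * poisson J sigma setT <= (a ^+ 2)%:E)%E) ->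
  (forall (delta : R) (J : set R), 0 < delta -> bounded_interval J ->
    (\int[omega]_(x in J) (`|truncated_hilbert zeta delta J sigma x| ^+ 2)%:E
      <= (h ^+ 2)%:E * sigma J)%E) ->
  bounded_interval I0 -> interval_decomposition I0 I ->
  (\sum_(0 <= r <oo) omega (I r) * ((energy (I r) omega) ^+ 2)%:E
      * poisson (I r) sigma I0 ^+ 2
    <= (8 * h ^+ 2 + 2 * a ^+ 2)%:E * sigma I0)%E.
Proof.
move=> zetaP lo ls HA HT bI0 [itvI tI I0E].
have mI0 := bounded_interval_measurable bI0; have [_ bdI0] := bI0.
have II0 r : I r `<=` I0 by rewrite I0E; exact: bigcup_sup.
have bI r : bounded_interval (I r).
  by split => //; case: bdI0 => M [Mr HM]; exists M; split => // y My x /II0; exact: HM.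
have mI r : measurable (I r : set (measurableTypeR R)).
  exact: bounded_interval_measurable.
have sI0 := locally_finite_bounded ls mI0 bdI0.
have oI0 := locally_finite_bounded lo mI0 bdI0.
have sIr r : (sigma (I r) < +oo)%E.
  by apply: le_lt_trans sI0; apply: le_measure; rewrite ?inE//; exact: mI.
have errE r := cid2 (energy_term_le zetaP mI0 sI0 oI0 (bI r) (II0 r)
  (HA _ (bI r)) (fun delta d0 => HT delta _ d0 (bI r))).
pose err r := s2val (errE r).
have sI0E : sigma I0 = (fine (sigma I0))%:E by rewrite fineK// ge0_fin_numE.
(* The number [N] of pieces is fixed before the scale tends to [0], since only a finite sum of
   errors is known to vanish. *)
apply: lime_le.
  apply: is_cvg_ereal_nneg_natsum_cond => r _ _.
  by rewrite mule_ge0 ?expe_ge0 ?poisson_ge0// mule_ge0// lee_fin sqr_ge0.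
apply: nearW => N; rewrite sI0E -EFinM.
have cvgE : (((8 * h ^+ 2 + 2 * a ^+ 2) * fine (sigma I0)
    + \sum_(0 <= r < N) err r n)%:E @[n --> \oo]
    --> ((8 * h ^+ 2 + 2 * a ^+ 2) * fine (sigma I0))%:E)%E.
  apply: cvg_EFin; first exact: nearW.
  rewrite /= -[X in _ --> X]addr0; apply: cvgD; first exact: cvg_cst.
  rewrite -[X in _ --> X](@big1_eq _ _ +%R _ (index_iota 0 N) xpredT).
  by apply: cvg_big => [|r _]; [exact: add_continuous|exact: (s2valP (errE r))].
rewrite -(cvg_lim _ cvgE)//; apply: lime_ge; first by apply/cvg_ex; eexists; exact: cvgE.
apply: nearW => n; set delta := n.+1%:R^-1 : R.
have d0 : 0 < delta by rewrite invr_gt0.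
have iT (J : set (measurableTypeR R)) (mJ : measurable J) (JI0 : J `<=` I0) :=
  integrable_truncated_hilbert_sqr zetaP mI0 sI0 oI0 d0 mJ JI0 mI0 (@subset_refl _ I0).
(* The pieces are disjoint with union [I0], so a partial sum is at most the integral over [I0],
   which testing bounds. *)
have sumT : \sum_(0 <= r < N)
    \int[omega]_(x in I r) truncated_hilbert zeta delta I0 sigma x ^+ 2
    <= h ^+ 2 * fine (sigma I0).
  rewrite -lee_fin EFinM -sI0E; apply: le_trans (HT _ _ d0 bI0).
  under [leRHS]eq_integral do rewrite real_normK ?num_real//.
  rewrite [X in (_ <= integral _ X _)%E]I0E ge0_integral_bigcup//; last 2 first.
  - rewrite -I0E; exact: measurable_int (iT _ mI0 (@subset_refl _ I0)).
  - by move=> x _; rewrite lee_fin sqr_ge0.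
  rewrite -sumEFin; apply: le_trans (nneseries_lim_ge N _); last first.
    by move=> r _ _; apply: integral_ge0 => x _; rewrite lee_fin sqr_ge0.
  apply: lee_sum => r _; rewrite /Rintegral fineK//.
  exact: (integrable_fin_num (mI r) (iT _ (mI r) (II0 r))).
have sums : \sum_(0 <= r < N) fine (sigma (I r)) <= fine (sigma I0).
  rewrite -lee_fin -sI0E [in leRHS]I0E measure_semi_bigcup -?I0E//.
  rewrite -sumEFin; apply: le_trans (nneseries_lim_ge N _); last by [].
  by apply: lee_sum => r _; rewrite fineK// ge0_fin_numE.
apply: (@le_trans _ _ (\sum_(0 <= r < N) (
    4 * \int[omega]_(x in I r) truncated_hilbert zeta delta I0 sigma x ^+ 2 +
    (4 * h ^+ 2 + 2 * a ^+ 2) * fine (sigma (I r)) + err r n)%:E)%E).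
  by apply: lee_sum => r _; exact: (s2valP' (errE r)).
rewrite sumEFin lee_fin !big_split/= lerD2r -!mulr_sumr.
apply: (@le_trans _ _ (4 * (h ^+ 2 * fine (sigma I0)) +
    (4 * h ^+ 2 + 2 * a ^+ 2) * fine (sigma I0))).
  apply: lerD; first exact: ler_wpM2l.
  by apply: ler_wpM2l => //; apply: addr_ge0; exact/mulr_ge0/sqr_ge0.
by rewrite le_eqVlt; apply/orP; left; apply/eqP; ring.
Qed.

Lemma A2C omega sigma : A2 omega sigma = A2 sigma omega.
Proof.
rewrite /A2; congr (sqrte (ereal_sup _)).
by apply: eq_imagel => J _; rewrite muleC.
Qed.

Lemma poisson_mul_le omega sigma (a : R) (J : set R) :
  A2 omega sigma = a%:E -> bounded_interval J ->
  (poisson J omega setT * poisson J sigma setT <= (a ^+ 2)%:E)%E.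
Proof.
(* Squaring undoes [sqrte] because the supremum is nonnegative, as the product at [J] shows. *)
move=> A2a bJ; rewrite EFin_expe -A2a /A2 sqr_sqrte; last first.
  apply: le_ereal_sup_tmp; exists (poisson J omega setT * poisson J sigma setT)%E.
    by exists J.
  by rewrite mule_ge0 ?poisson_ge0.
by apply: ereal_sup_ubound; exists J.
Qed.

(** If either constant is infinite, so is the right-hand side. Otherwise an admissible [h] close to
    the testing infimum makes [3 * (a + h)] admissible for the energy condition. *)
Lemma energy_constant_le (zeta : R -> R) sigma omega :
  cutoff zeta -> locally_finite omega -> locally_finite sigma ->
  (energy_constant sigma omega <=
    3%:E * (A2 omega sigma + testing zeta sigma omega))%E.
Proof.
move=> zetaP lo ls.
have t0 : (0 <= testing zeta sigma omega)%E.
  by apply: le_ereal_inf_tmp => _ [c [c0 _] <-]; rewrite lee_fin.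
have := sqrte_ge0 (ereal_sup [set (poisson I omega setT * poisson I sigma setT)%E
       | I in [set I : set R | bounded_interval I]]).
rewrite -/(A2 omega sigma) => A0.
case A2a : (A2 omega sigma) A0 => [a| |] //; last first.
  by rewrite addye ?gt0_muley ?leey ?lte_fin// gt_eqF// (lt_le_trans _ t0).
rewrite lee_fin => a0.
case Tt : (testing zeta sigma omega) t0 => [t| |] // t0; last first.
  by rewrite addey ?gt0_muley ?leey ?lte_fin.
apply/lee_addgt0Pr => e e0.
(* The infimum need not be known to be attained; a margin of [e / 3] becomes [e] after
   multiplication by [3]. *)
have e30 : 0 < e / 3 by rewrite divr_gt0.
have tfin : testing zeta sigma omega \is a fin_num by rewrite Tt.
have [_ [h [h0 HT] <-]] := lb_ereal_inf_adherent e30 tfin.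
rewrite [ereal_inf _]Tt -EFinD lte_fin => hte.
apply: (@le_trans _ _ (3 * (a + h))%:E); last first.
  by rewrite -EFinD lee_fin; lra.
apply: ereal_inf_lbound; exists (3 * (a + h)) => //; split.
  by rewrite mulr_ge0// addr_ge0.
move=> I0 I bI0 dI.
have HA (J : set R) (bJ : bounded_interval J) := poisson_mul_le A2a bJ.
apply: le_trans (energy_sum_le zetaP lo ls HA HT bI0 dI) _.
apply: lee_wpmul2r => //; rewrite lee_fin.
(* The constant [3] suffices since [8 * h ^+ 2 + 2 * a ^+ 2 <= 9 * (a + h) ^+ 2] for nonnegative [a]
   and [h]. *)
by have := mulr_ge0 a0 h0; have := sqr_ge0 h; have := sqr_ge0 a; nra.
Qed.

End energy_constant.

Theorem proposition2p11 (R : realType) :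
  exists C : R, 0 < C /\
    forall (zeta : R -> R), cutoff zeta ->
    forall (omega sigma : borel_measure R),
      locally_finite omega -> locally_finite sigma ->
      no_common_point_mass omega sigma ->
      (energy_constant sigma omega
         <= C%:E * (A2 omega sigma + testing zeta sigma omega))%E /\
      (energy_constant omega sigma
         <= C%:E * (A2 omega sigma + testing zeta omega sigma))%E.
Proof.
exists 3; split=> // zeta zetaP omega sigma lo ls _; split.
  exact: energy_constant_le.
by rewrite A2C; exact: energy_constant_le.
Qed.
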